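(* Let $k,n\in\mathbb{N}$ with $k\ge 1$ and let $w\in\{0,1\}^{\mathbb{N}}$ be an infinite sequence such that for every $j$ with $0\le j\le k$, the word $w_{[j,j+n)}$ is colourable if and only if $j\in\{0,k\}$. Then $\psi(w_{[0,n)})\neq\psi(w_{[k,k+n)})$.
   Context: For a (finite or infinite) sequence $w=w_0w_1\dots$ over $\{0,1\}$, $w_{[a,b)}=w_a\dots w_{b-1}$. For a finite string $w$ over $\{0,1\}$, $\#w$ is its length, $\varepsilon$ the empty string; for $\#w\ge1$, $l(w)$ is $w$ without its last letter and $r(w)$ is $w$ without its first letter. $T^n$ is the alternating string of length $n$ starting with $0$ ($T^0=\varepsilon$, $T^n=T^{n-1}0$ for odd $n$, $T^n=T^{n-1}1$ for even $n\ge2$) and $CT^n$ its letterwise complement. $\xi$: $\xi(\varepsilon)=0$; $\xi(w)=1$ if $w=T^k$, $k\ge2$ even; $\xi(w)=-1$ if $w=CT^k$, $k\ge2$ even; otherwise $\xi(w)=\operatorname{sgn}(\xi(l(w))+\xi(r(w)))$. $\phi$: $\phi(\varepsilon)=0$; $\phi(w)=-1$ if $w=0^k$, $k$ odd; $\phi(w)=1$ if $w=1^k$, $k$ odd; otherwise $\phi(w)=\operatorname{sgn}(\phi(r(w))-\phi(l(w)))$. $\psi(w)=\xi(w)^{\#w}\phi(w)$ (with $0^0=1$); $w$ is colourable iff $\psi(w)\ne0$. *)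

(* Defs.v *)
From HB Require Import structures.
From mathcomp Require Import all_boot all_order all_algebra.

Set Implicit Arguments.
Unset Strict Implicit.
Unset Printing Implicit Defensive.

Import Order.TTheory GRing.Theory Num.Theory.
Local Open Scope ring_scope.

(* The letters 0 and 1 are false and true. *)
Definition word := seq bool.

(* The factor w_a ... w_(b-1). *)
Definition factor (w : nat -> bool) (a b : nat) : word :=
  [seq w i | i <- iota a (b - a)].

Definition lw (w : word) : word := take (size w).-1 w.
Definition rw (w : word) : word := behead w.

Fixpoint T (n : nat) : word :=
  if n is m.+1 then rcons (T m) (~~ odd n) else [::].
Definition CT (n : nat) : word := map negb (T n).

(* The recursion on l(w) and r(w) is run with the length of w as fuel; xi_nil,
   xi_T, xi_CT, xi_step and phi_nil, phi_0, phi_1, phi_step below are the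
   defining equations. *)
Fixpoint xi_rec (fuel : nat) (w : word) : int :=
  if fuel is m.+1 then
    let k := size w in
    if [&& w == T k, (2 <= k)%N & ~~ odd k] then 1
    else if [&& w == CT k, (2 <= k)%N & ~~ odd k] then -1
    else Num.sg (xi_rec m (lw w) + xi_rec m (rw w))
  else 0.
Definition xi (w : word) : int := xi_rec (size w) w.

Fixpoint phi_rec (fuel : nat) (w : word) : int :=
  if fuel is m.+1 then
    let k := size w in
    if (w == nseq k false) && odd k then -1
    else if (w == nseq k true) && odd k then 1
    else Num.sg (phi_rec m (rw w) - phi_rec m (lw w))
  else 0.
Definition phi (w : word) : int := phi_rec (size w) w.

Definition psi (w : word) : int := xi w ^+ size w * phi w.

Definition colourable (w : word) : Prop := psi w <> 0.

Lemma lw_rcons (w : word) (a : bool) : lw (rcons w a) = w.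
Proof. by rewrite /lw size_rcons /= -cats1 take_size_cat. Qed.

Lemma size_lw (w : word) : size (lw w) = (size w).-1.
Proof. by rewrite size_take; case: w => //= a s; rewrite ltnSn. Qed.

Lemma size_rw (w : word) : size (rw w) = (size w).-1.
Proof. exact: size_behead. Qed.

Lemma size_T (n : nat) : size (T n) = n.
Proof. by elim: n => //= n IHn; rewrite size_rcons IHn. Qed.

Lemma size_CT (n : nat) : size (CT n) = n.
Proof. by rewrite size_map size_T. Qed.

Lemma T_head (n : nat) : (0 < n)%N -> head true (T n) = false.
Proof.
case: n => // n _; elim: n => // n IHn.
have -> : T n.+2 = rcons (T n.+1) (~~ odd n.+2) by [].
by move: IHn (size_T n.+1); case: (T n.+1).
Qed.

Lemma CT_neq_T (n : nat) : (0 < n)%N -> CT n <> T n.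
Proof.
move=> n_gt0; rewrite /CT; move: (T_head n_gt0) (size_T n).
case: (T n) => [|a s] /=; first by move=> _ e; rewrite -e in n_gt0.
by move=> -> _ [].
Qed.

Lemma xi_nil : xi [::] = 0.
Proof. by []. Qed.

Lemma xi_T (k : nat) : (2 <= k)%N -> ~~ odd k -> xi (T k) = 1.
Proof.
move=> k2 ek; rewrite /xi size_T; case: k k2 ek => // k k2 ek.
by rewrite [LHS]/= -/(T k.+1) size_T eqxx k2 ek.
Qed.

Lemma xi_CT (k : nat) : (2 <= k)%N -> ~~ odd k -> xi (CT k) = -1.
Proof.
move=> k2 ek; rewrite /xi size_CT; case: k k2 ek => // k k2 ek.
rewrite /xi_rec -/xi_rec size_CT eqxx k2 ek; case: eqP => // e.
by case: (@CT_neq_T k.+1).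
Qed.

Lemma xi_step (w : word) :
  (0 < size w)%N ->
  (forall k : nat, (2 <= k)%N -> ~~ odd k -> w <> T k) ->
  (forall k : nat, (2 <= k)%N -> ~~ odd k -> w <> CT k) ->
  xi w = Num.sg (xi (lw w) + xi (rw w)).
Proof.
rewrite /xi size_lw size_rw; case e: (size w) => [|n] // _ nT nCT.
rewrite /xi_rec -/xi_rec e [n.+1.-1]/=.
case: and3P => [[/eqP wT k2 ek]|_]; first by case: (nT _ k2 ek).
by case: and3P => [[/eqP wT k2 ek]|_]; first by case: (nCT _ k2 ek).
Qed.

Lemma phi_nil : phi [::] = 0.
Proof. by []. Qed.

Lemma phi_0 (k : nat) : odd k -> phi (nseq k false) = -1.
Proof.
move=> ok; rewrite /phi size_nseq; case: k ok => // k ok.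
by rewrite /phi_rec -/phi_rec size_nseq eqxx ok.
Qed.

Lemma phi_1 (k : nat) : odd k -> phi (nseq k true) = 1.
Proof.
move=> ok; rewrite /phi size_nseq; case: k ok => // k ok.
by rewrite /phi_rec -/phi_rec size_nseq eqxx ok andbT.
Qed.

Lemma phi_step (w : word) :
  (0 < size w)%N ->
  (forall k : nat, odd k -> w <> nseq k false) ->
  (forall k : nat, odd k -> w <> nseq k true) ->
  phi w = Num.sg (phi (rw w) - phi (lw w)).
Proof.
rewrite /phi size_lw size_rw; case e: (size w) => [|n] // _ n0 n1.
rewrite /phi_rec -/phi_rec e [n.+1.-1]/=.
case: andP => [[/eqP w0 ok]|_]; first by case: (n0 _ ok).
by case: andP => [[/eqP w1 ok]|_]; first by case: (n1 _ ok).
Qed.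

(* Main.v *)
Require Import Defs.
From mathcomp Require Import all_boot all_order all_algebra.
From mathcomp Require Import zify.

(** Write xi_n(i), phi_n(i), psi_n(i) for the values on the factor of length n
    at position i.  If a sequence p with values in {-1, 0, 1} has the same sign
    on both sides of every run of zeros, then the nonzero terms of
    sgn (p(i+1) - p(i)) alternate in sign.  For n > 0, psi_n is of this form:
    for even n with p = phi_(n-1), which never vanishes, and for odd n with
    p = xi_(n-1) phi_(n-1).  In the odd case both factors of p have the same
    zeros and both change sign across every run of zeros, so that their product
    keeps its sign.

    These facts about even lengths are proved by induction, together with the
    facts that two adjacent zeros of xi_n come from a constant factor and three
    nonzero values with two sign changes from an alternating one; the latter
    say that the exceptional clauses in the definitions of xi and phi apply
    exactly where needed. *)

Set Implicit Arguments.
Unset Strict Implicit.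
Unset Printing Implicit Defensive.

Import GRing.Theory Num.Theory.
Local Open Scope ring_scope.

(** * Sequences of signs *)

Definition sign_valued (u : nat -> int) : Prop := forall i, -1 <= u i <= 1.

Definition consecutive_nonzero (u : nat -> int) (i j : nat) : Prop :=
  [/\ (i < j)%N, u i != 0, u j != 0 & forall l, (i < l < j)%N -> u l = 0].

Definition alternates (u : nat -> int) : Prop :=
  forall i j, consecutive_nonzero u i j -> u j = - u i.

Definition alternates_across_zeros (u : nat -> int) : Prop :=
  forall i j, (i.+1 < j)%N -> consecutive_nonzero u i j -> u j = - u i.

Definition constant_across_zeros (u : nat -> int) : Prop :=
  forall i j, (i.+1 < j)%N -> consecutive_nonzero u i j -> u j = u i.

(* The coefficients only encode a rule on triples of signs: the middle sign
   wins unless both neighbours oppose it, and a middle 0 leaves the decision to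
   its neighbours. *)
Definition window_sign (x y z : int) : int := Num.sg (2 * x + 3 * y + 2 * z).

Section SignSequences.

Implicit Types a b p u : nat -> int.

Lemma alternates_succ u i :
  alternates u -> u i != 0 -> u i.+1 != 0 -> u i.+1 = - u i.
Proof. by move=> u_alt ui uSi; apply: u_alt; split=> // l; lia. Qed.

Lemma alternates_across_zero u i : alternates_across_zeros u ->
  u i != 0 -> u i.+1 = 0 -> u i.+2 != 0 -> u i.+2 = - u i.
Proof.
move=> u_alt ui uSi uSSi; apply: u_alt => //; split=> // l il.
by have -> : l = i.+1 by lia.
Qed.

Lemma alternatesW u : alternates u -> alternates_across_zeros u.
Proof. by move=> u_alt i j _; apply: u_alt. Qed.

Lemma nonzero_constant_across_zeros u :
  (forall i, u i != 0) -> constant_across_zeros u.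
Proof.
move=> u_neq0 i j ij [_ _ _ /(_ i.+1)]; rewrite ltnSn ij => /(_ isT)/eqP.
by rewrite (negbTE (u_neq0 _)).
Qed.

Lemma constant_across_zeros_mul a b :
  (forall i, (a i == 0) = (b i == 0)) ->
  alternates_across_zeros a -> alternates_across_zeros b ->
  constant_across_zeros (fun i => a i * b i).
Proof.
move=> ab0 a_alt b_alt i j ij [_].
rewrite !mulf_eq0 -!ab0 !orbb => ai aj ab_zero.
have a_zero l : (i < l < j)%N -> a l = 0.
  by move=> /ab_zero/eqP; rewrite mulf_eq0 -ab0 orbb => /eqP.
rewrite (a_alt i j) ?(b_alt i j) ?mulrNN//; split; rewrite -?ab0 ?(ltnW ij)//.
by move=> l /a_zero/eqP; rewrite ab0 => /eqP.
Qed.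

Lemma alternates_sg_diff p u :
  sign_valued p -> constant_across_zeros p ->
  (forall i, u i = Num.sg (p i.+1 - p i)) -> alternates u.
Proof.
move=> p_sign p_const uE i j [ij]; rewrite !uE => ui uj u_zero.
have p_eq l : (i < l <= j)%N -> p l = p i.+1.
  elim: l => // l IHl il; have [->//|i_neq_l] := eqVneq i l.
  by rewrite -IHl; last lia; have := u_zero l; rewrite uE; lia.
have pj := p_eq j; have [p_run|p_run] := eqVneq (p i.+1) 0.
  have : p j.+1 = p i; last lia.
  by apply: p_const; [lia|split=> [|||l il]; [lia..|rewrite p_eq//; lia]].
by have := p_sign i; have := p_sign i.+1; have := p_sign j.+1; lia.
Qed.

Lemma sg_add_mul_sg_diff a b i :
  sign_valued a -> sign_valued b -> (forall j, (a j == 0) = (b j == 0)) ->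
  alternates b ->
  Num.sg (a i + a i.+1) * Num.sg (b i.+1 - b i) =
  Num.sg (a i.+1 * b i.+1 - a i * b i).
Proof.
move=> a_sign b_sign ab0 b_alt.
have values l : [|| (a l == 0) && (b l == 0), (a l == 1) && (b l == 1),
    (a l == 1) && (b l == -1), (a l == -1) && (b l == 1) |
    (a l == -1) && (b l == -1)].
  by have := a_sign l; have := b_sign l; have := ab0 l; lia.
have := @alternates_succ b i b_alt.
case/or4P: (values i) => [|||/orP[]] /andP[/eqP-> /eqP->];
case/or4P: (values i.+1) => [|||/orP[]] /andP[/eqP-> /eqP->];
by [|move/(_ isT isT)].
Qed.

Lemma window_sign_eq0 x y z : -1 <= x <= 1 -> -1 <= y <= 1 -> -1 <= z <= 1 ->
  (window_sign x y z == 0) = (y == 0) && (z == - x).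
Proof. by rewrite /window_sign; lia. Qed.

Lemma alternates_across_zeros_window a u :
  sign_valued a -> alternates_across_zeros a ->
  (forall i, u i = window_sign (a i) (a i.+1) (a i.+2)) ->
  alternates_across_zeros u.
Proof.
move=> a_sign a_alt uE i j ij [_ ui uj u_zero].
have a_run l : (i.+1 < l <= j)%N -> a l = 0 /\ a l.+1 = - a l.-1.
  case: l => // l il; have /eqP := u_zero l il.
  by rewrite uE window_sign_eq0// => /andP[/eqP-> /eqP->].
have [a2 a3] : a i.+2 = 0 /\ a i.+3 = - a i.+1 by apply: a_run; lia.
have [aj aSj] : a j = 0 /\ a j.+1 = - a j.-1 by apply: a_run; lia.
rewrite !uE /window_sign a2 aj in ui uj *.
have := a_sign i; have := a_sign j.+2.
have [a1|a1] := eqVneq (a i.+1) 0.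
  have a_zero l : (i < l <= j)%N -> a l = 0.
    move=> il; have [->//|l_neq] := eqVneq l i.+1.
    by have [] := a_run l; first lia.
  have {}aSj : a j.+1 = 0 by rewrite aSj a_zero ?oppr0//; lia.
  rewrite a1 aSj in ui uj *.
  have ai_aj : consecutive_nonzero a i j.+2.
    split; [lia..|] => l il; have [->//|l_neq] := eqVneq l j.+1.
    by apply: a_zero; lia.
  by have := a_alt _ _ _ ai_aj; lia.
have jE : j = i.+2.
  by apply/eqP/negPn/negP => j_neq; have [] := a_run i.+3; rewrite /= ?a3; lia.
by subst j; rewrite a3; have := a_sign i.+1; lia.
Qed.

End SignSequences.

Lemma sign_expr (x : int) n : (0 < n)%N -> -1 <= x <= 1 ->
  x ^+ n = if odd n then x else (x != 0)%:R.
Proof.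
move=> n_gt0 x_sign.
have /or3P[] : [|| x == 0, x == 1 | x == -1] by lia.
- by move/eqP->; rewrite expr0n eqxx gtn_eqF//; case: ifP.
- by move/eqP->; rewrite expr1n; case: ifP.
- by move/eqP->; rewrite -signr_odd; case: ifP.
Qed.

(** * Constant and alternating factors *)

(* The constant word b b b ... for c = false, and the alternating word
   b (~~ b) b ... for c = true. *)
Definition step_word (c b : bool) (n : nat) : word :=
  mkseq (fun t => b (+) (c && odd t)) n.

Definition steps_at (c : bool) (w : nat -> bool) (n i : nat) : bool :=
  factor w i (i + n) == step_word c (w i) n.

Notation constant_at := (steps_at false).
Notation alternating_at := (steps_at true).

Lemma nseq_step_word n b : nseq n b = step_word false b n.
Proof.
apply: (@eq_from_nth _ false) => [|t]; rewrite size_nseq ?size_mkseq// => tn.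
by rewrite nth_nseq nth_mkseq// tn addbF.
Qed.

Lemma T_step_word n : T n = step_word true false n.
Proof. by elim: n => //= n ->; rewrite /step_word mkseqS negbK. Qed.

Lemma CT_step_word n : CT n = step_word true true n.
Proof. by rewrite /CT T_step_word /step_word /mkseq -map_comp. Qed.

Section Factors.

Variable w : nat -> bool.

Lemma factorE i n : factor w i (i + n) = mkseq (fun t => w (i + t)%N) n.
Proof. by rewrite /factor addKn /mkseq -[in LHS](addn0 i) iotaDl -map_comp. Qed.

Lemma size_factor i n : size (factor w i (i + n)) = n.
Proof. by rewrite factorE size_mkseq. Qed.

Lemma lw_factor i n : lw (factor w i (i + n.+1)) = factor w i (i + n).
Proof. by rewrite !factorE mkseqS lw_rcons. Qed.

Lemma rw_factor i n : rw (factor w i (i + n.+1)) = factor w i.+1 (i.+1 + n).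
Proof. by rewrite /factor !addKn. Qed.

Lemma stepsP c n i :
  reflect (forall j, (i <= j)%N -> (j.+1 < i + n)%N -> w j.+1 = w j (+) c)
          (steps_at c w n i).
Proof.
apply: (iffP eqP) => [wE j ij jn|w_step].
  have wt t : (t < n)%N -> w (i + t)%N = w i (+) (c && odd t).
    move=> tn; have := congr1 (nth false ^~ t) wE.
    by rewrite factorE !nth_mkseq.
  have -> : j = (i + (j - i))%N by lia.
  by rewrite -addnS !wt /= -?addbT ?andb_addr ?andbT ?addbA//; lia.
rewrite factorE; apply/eq_in_map => t; rewrite mem_iota /= => tn.
elim: t tn => [|t IHt] tn; first by rewrite addn0 andbF addbF.
by rewrite addnS w_step ?IHt /= -?addbT ?andb_addr ?andbT ?addbA//; lia.
Qed.

Lemma steps_at_sub c n i n' i' : (i <= i')%N -> (i' + n' <= i + n)%N ->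
  steps_at c w n i -> steps_at c w n' i'.
Proof.
by move=> ii' nn' /stepsP w_step; apply/stepsP => j ij jn; apply: w_step; lia.
Qed.

Lemma steps_at_overlap c n i : (1 < n)%N ->
  steps_at c w n i -> steps_at c w n i.+1 -> steps_at c w n.+1 i.
Proof.
move=> n_gt1 /stepsP w_stepi /stepsP w_stepSi; apply/stepsP => j ij jn.
by have [->|i_neq_j] := eqVneq j i; [apply: w_stepi|apply: w_stepSi]; lia.
Qed.

Lemma steps_at1 c i : steps_at c w 1 i.
Proof. by apply/stepsP => j; lia. Qed.

Lemma steps_at2 c i : steps_at c w 2 i = (w i.+1 == w i (+) c).
Proof.
apply/stepsP/eqP => [w_step|w_stepSi j ij ji]; first by apply: w_step; lia.
by have -> : j = i by lia.
Qed.

Lemma steps_at_next c n i : (1 < n)%N -> steps_at c w n i -> w i.+1 = w i (+) c.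
Proof. by move=> n_gt1 /stepsP; apply; lia. Qed.

Lemma factor_step_word c b n i m :
  factor w i (i + n.+1) = step_word c b m -> m = n.+1 /\ steps_at c w n.+1 i.
Proof.
move=> wE; have mE : m = n.+1 by rewrite -(size_factor i n.+1) wE size_mkseq.
have b_eq : w i = b.
  by have := congr1 (head false) wE; rewrite factorE mE /= addn0 andbF addbF.
by split=> //; rewrite /steps_at wE mE b_eq.
Qed.

End Factors.

(** * The signs of the factors of a fixed length *)

Definition xi_at (w : nat -> bool) (n i : nat) : int :=
  xi (factor w i (i + n)).

Definition phi_at (w : nat -> bool) (n i : nat) : int :=
  phi (factor w i (i + n)).

Definition psi_at (w : nat -> bool) (n i : nat) : int :=
  psi (factor w i (i + n)).

Definition letter_sign (b : bool) : int := if b then 1 else -1.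

Section FactorSigns.

Variable w : nat -> bool.

Lemma xi_at_sign_valued n : sign_valued (xi_at w n).
Proof.
move=> i; rewrite /xi_at /xi; case: (size _) => //= m.
by do 2 case: ifP => // _; lia.
Qed.

Lemma phi_at_sign_valued n : sign_valued (phi_at w n).
Proof.
move=> i; rewrite /phi_at /phi; case: (size _) => //= m.
by do 2 case: ifP => // _; lia.
Qed.

Lemma xi_at_alternating n i : (0 < n)%N -> ~~ odd n -> alternating_at w n i ->
  xi_at w n i = - letter_sign (w i).
Proof.
move=> n_gt0 n_even /eqP w_alt; rewrite /xi_at w_alt.
have n_gt1 : (1 < n)%N by lia.
by case: (w i); rewrite -?CT_step_word -?T_step_word ?xi_CT ?xi_T.
Qed.

Lemma xi_atS n i : odd n.+1 || ~~ alternating_at w n.+1 i ->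
  xi_at w n.+1 i = Num.sg (xi_at w n i + xi_at w n i.+1).
Proof.
move=> w_step; rewrite /xi_at xi_step ?size_factor ?lw_factor ?rw_factor//;
  move=> k _ k_even; rewrite ?T_step_word ?CT_step_word;
  move=> /factor_step_word[kE w_alt];
  by rewrite w_alt -kE (negbTE k_even) in w_step.
Qed.

Lemma phi_atS n i : ~~ (odd n.+1 && constant_at w n.+1 i) ->
  phi_at w n.+1 i = Num.sg (phi_at w n i.+1 - phi_at w n i).
Proof.
move=> w_step; rewrite /phi_at phi_step ?size_factor ?lw_factor ?rw_factor//;
  move=> k k_odd; rewrite nseq_step_word => /factor_step_word[kE w_const];
  by rewrite w_const -kE k_odd in w_step.
Qed.

Lemma xi_at_constant n i : constant_at w n i -> xi_at w n i = 0.
Proof.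
elim: n i => [|n IHn] i w_const; first by rewrite /xi_at factorE.
rewrite xi_atS.
  by rewrite !IHn//; apply: steps_at_sub w_const; lia.
case: n w_const {IHn} => // n w_const.
apply/orP; right; apply/negP => /steps_at_next.
by rewrite (steps_at_next _ w_const)//; case: (w i) => /(_ isT).
Qed.

Lemma phi_at_constant n i : constant_at w n i ->
  phi_at w n i = letter_sign (w i) *+ odd n.
Proof.
have odd_case m j : odd m -> constant_at w m j ->
    phi_at w m j = letter_sign (w j).
  move=> m_odd /eqP w_const; rewrite /phi_at w_const -nseq_step_word.
  by case: (w j); rewrite ?phi_0 ?phi_1.
case n_odd: (odd n) => w_const; first exact: odd_case.
case: n n_odd w_const => [|[|n]] // n_even w_const.
  by rewrite /phi_at factorE.
have n_odd : odd n.+1 by apply: negbFE.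
rewrite phi_atS ?n_even// !odd_case//; try by apply: steps_at_sub w_const; lia.
by rewrite (steps_at_next _ w_const)// addbF subrr.
Qed.

Lemma phi_at_last_differs n i :
  constant_at w n.+1 i -> ~~ constant_at w n.+2 i ->
  phi_at w n.+2 i = - letter_sign (w i).
Proof.
elim: n i => [|n IHn] i w_const w_nconst.
  rewrite phi_atS ?(negbTE w_nconst)// !phi_at_constant ?steps_at1//.
  by move: w_nconst; rewrite steps_at2; case: (w i); case: (w i.+1).
rewrite phi_atS ?(negbTE w_nconst) ?andbF// (phi_at_constant w_const) IHn.
- by rewrite (steps_at_next _ w_const)// addbF /=; case: (odd n); case: (w i).
- by apply: steps_at_sub w_const; lia.
- by apply: contra w_nconst; apply: steps_at_overlap.
Qed.

Lemma phi_at_first_differs n i :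
  constant_at w n.+1 i.+1 -> ~~ constant_at w n.+2 i ->
  phi_at w n.+2 i = (-1) ^+ n * letter_sign (w i.+1).
Proof.
elim: n => [|n IHn] w_const w_nconst.
  rewrite phi_atS ?(negbTE w_nconst)// !phi_at_constant ?steps_at1//.
  by move: w_nconst; rewrite steps_at2; case: (w i); case: (w i.+1).
rewrite phi_atS ?(negbTE w_nconst) ?andbF// (phi_at_constant w_const) IHn.
- by rewrite exprS -signr_odd /=; case: (odd n); case: (w i.+1).
- by apply: steps_at_sub w_const; lia.
- by apply: contra w_nconst => w_const'; apply: steps_at_overlap.
Qed.

End FactorSigns.

(** * Even lengths *)

Record even_pattern (w : nat -> bool) (n : nat) : Prop := {
  xi_phi_eq0 : forall i, (xi_at w n i == 0) = (phi_at w n i == 0);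
  phi_alternates : alternates (phi_at w n);
  xi_alternates : alternates_across_zeros (xi_at w n);
  zeros_constant : forall i,
    xi_at w n i = 0 -> xi_at w n i.+1 = 0 -> constant_at w n.+1 i;
  sign_changes_alternating : forall i,
    xi_at w n i != 0 -> xi_at w n i.+1 = - xi_at w n i ->
    xi_at w n i.+2 = xi_at w n i -> alternating_at w n.+2 i }.

Lemma even_pattern0 (w : nat -> bool) : even_pattern w 0.
Proof.
have xi0 i : xi_at w 0 i = 0 by rewrite /xi_at factorE.
have phi0 i : phi_at w 0 i = 0 by rewrite /phi_at factorE.
split=> [i|i j []|i j _ []|i _ _|i]; rewrite ?xi0 ?phi0 ?eqxx//.
exact: steps_at1.
Qed.

Section EvenStep.

Variables (w : nat -> bool) (n : nat).
Hypotheses (n_even : ~~ odd n) (pat : even_pattern w n).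

Lemma phi_at_odd_sg_diff i : (xi_at w n i != 0) || (xi_at w n i.+1 != 0) ->
  phi_at w n.+1 i = Num.sg (phi_at w n i.+1 - phi_at w n i).
Proof.
move=> xi_neq0; apply: phi_atS; apply: contraL xi_neq0 => /andP[_ w_const].
by rewrite !xi_at_constant//; apply: steps_at_sub w_const; lia.
Qed.

Lemma phi_at_odd_left i : phi_at w n i != 0 -> phi_at w n.+1 i = - phi_at w n i.
Proof.
move=> phi_neq0; rewrite phi_at_odd_sg_diff ?(xi_phi_eq0 pat) ?phi_neq0//.
have := alternates_succ (phi_alternates pat) phi_neq0.
by have := phi_at_sign_valued w n i; lia.
Qed.

Lemma phi_at_odd_right i :
  phi_at w n i.+1 != 0 -> phi_at w n.+1 i = phi_at w n i.+1.
Proof.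
move=> phi_neq0; rewrite phi_at_odd_sg_diff ?(xi_phi_eq0 pat) ?phi_neq0 ?orbT//.
have := @alternates_succ _ i (phi_alternates pat).
by have := phi_at_sign_valued w n i.+1; lia.
Qed.

Lemma phi_at_odd_zeros i : xi_at w n i = 0 -> xi_at w n i.+1 = 0 ->
  phi_at w n.+1 i = letter_sign (w i).
Proof.
by move=> xi0 xi1; rewrite phi_at_constant ?(zeros_constant pat)//= n_even.
Qed.

Lemma phi_at_odd_neq0 i : phi_at w n.+1 i != 0.
Proof.
have [phi0|phi0] := eqVneq (phi_at w n i) 0; last first.
  by rewrite phi_at_odd_left ?oppr_eq0.
have [phi1|phi1] := eqVneq (phi_at w n i.+1) 0; last first.
  by rewrite phi_at_odd_right.
rewrite phi_at_odd_zeros; first by case: (w i).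
- by apply/eqP; rewrite (xi_phi_eq0 pat) phi0.
- by apply/eqP; rewrite (xi_phi_eq0 pat) phi1.
Qed.

Lemma phi_at_even_sg_diff i :
  phi_at w n.+2 i = Num.sg (phi_at w n.+1 i.+1 - phi_at w n.+1 i).
Proof. by rewrite phi_atS//= negbK (negbTE n_even). Qed.

Lemma phi_alternates_step : alternates (phi_at w n.+2).
Proof.
apply: alternates_sg_diff (@phi_at_sign_valued w n.+1) _ phi_at_even_sg_diff.
exact: nonzero_constant_across_zeros phi_at_odd_neq0.
Qed.

(* For n = 0 the next lemma fails: xi vanishes on the empty word, but not on an
   alternating word of length 2. *)
Hypothesis n_gt0 : (0 < n)%N.

Lemma xi_at_window i :
  xi_at w n.+2 i =
  window_sign (xi_at w n i) (xi_at w n i.+1) (xi_at w n i.+2).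
Proof.
have [w_alt|w_nalt] := boolP (alternating_at w n.+2 i).
  have w_alt1 : alternating_at w n.+1 i.+1 by apply: steps_at_sub w_alt; lia.
  rewrite !xi_at_alternating//=; try (by apply: steps_at_sub w_alt; lia).
  - rewrite (steps_at_next _ w_alt1)// (steps_at_next _ w_alt)//.
    by case: (w i).
  - by rewrite negbK.
rewrite xi_atS ?w_nalt ?orbT// !(@xi_atS w n) /= ?n_even//.
have : ~~ [&& xi_at w n i != 0, xi_at w n i.+1 == - xi_at w n i
    & xi_at w n i.+2 == xi_at w n i].
  apply: contra w_nalt => /and3P[xi0 /eqP xi1 /eqP xi2].
  exact: sign_changes_alternating.
have := xi_at_sign_valued w n i; have := xi_at_sign_valued w n i.+1.
by have := xi_at_sign_valued w n i.+2; rewrite /window_sign; lia.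
Qed.

Lemma phi_at_zeros_end i : xi_at w n i = 0 -> xi_at w n i.+1 = 0 ->
  xi_at w n i.+2 != 0 -> phi_at w n i.+2 = - phi_at w n.+1 i.
Proof.
move=> xi0 xi1; have w_const := zeros_constant pat xi0 xi1.
rewrite phi_at_odd_zeros//.
case: n n_even n_gt0 w_const => [|[|m]] // _ _ w_const xi2.
have w_const2 : constant_at w m.+1 i.+2 by apply: steps_at_sub w_const; lia.
rewrite phi_at_last_differs//; last by apply: contra xi2 => /xi_at_constant ->.
have w_const1 : constant_at w m.+2 i.+1 by apply: steps_at_sub w_const; lia.
by rewrite (steps_at_next _ w_const1)// (steps_at_next _ w_const)// !addbF.
Qed.

Lemma phi_at_zeros_start i : xi_at w n i != 0 -> xi_at w n i.+1 = 0 ->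
  xi_at w n i.+2 = 0 -> phi_at w n i = phi_at w n.+1 i.+1.
Proof.
move=> xi0 xi1 xi2; have w_const := zeros_constant pat xi1 xi2.
rewrite [RHS]phi_at_odd_zeros//.
case: n n_even n_gt0 w_const xi0 => [|[|m]] // m_even _ w_const xi0.
rewrite phi_at_first_differs.
- have m_oddF : odd m = false by lia.
  by rewrite -signr_odd m_oddF mul1r.
- by apply: steps_at_sub w_const; lia.
- by apply: contra xi0 => /xi_at_constant ->.
Qed.

Lemma phi_at_odd_eq i :
  (phi_at w n.+1 i.+1 == phi_at w n.+1 i) =
  (xi_at w n i.+1 == 0) && (xi_at w n i.+2 == - xi_at w n i).
Proof.
have xi_phi := xi_phi_eq0 pat; have phi_neq0 := phi_at_odd_neq0.
have phi_neqN j : (phi_at w n.+1 j == - phi_at w n.+1 j) = false.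
  by have := phi_neq0 j; lia.
have [xi1|xi1] := eqVneq (xi_at w n i.+1) 0; last first.
  rewrite xi_phi in xi1.
  by rewrite phi_at_odd_left// -phi_at_odd_right// eq_sym phi_neqN.
have [xi0|xi0] := eqVneq (xi_at w n i) 0;
  have [xi2|xi2] := eqVneq (xi_at w n i.+2) 0.
- have w_const := zeros_constant pat xi0 xi1.
  rewrite !phi_at_odd_zeros// (steps_at_next _ w_const)// addbF.
  by rewrite xi0 xi2 oppr0 !eqxx.
- have phi2 := phi_at_zeros_end xi0 xi1 xi2.
  rewrite phi_at_odd_right -?xi_phi// phi2 eq_sym phi_neqN.
  by rewrite xi0 oppr0 (negbTE xi2).
- have phi0 := phi_at_zeros_start xi0 xi1 xi2.
  rewrite -phi0 [phi_at w n.+1 i]phi_at_odd_left -?xi_phi// phi0 phi_neqN.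
  by rewrite xi2 eq_sym oppr_eq0 (negbTE xi0).
- have phi2 : phi_at w n i.+2 = - phi_at w n i.
    apply: (alternates_across_zero (alternatesW (phi_alternates pat)));
      by [rewrite -xi_phi|apply/eqP; rewrite -xi_phi xi1].
  rewrite phi_at_odd_right -?xi_phi// phi_at_odd_left -?xi_phi// phi2 eqxx.
  by rewrite (alternates_across_zero (xi_alternates pat) xi0 xi1 xi2) eqxx.
Qed.

Lemma even_pattern_step : even_pattern w n.+2.
Proof.
have sign := xi_at_sign_valued w n.
split=> [i|||i|i].
- rewrite xi_at_window window_sign_eq0// -phi_at_odd_eq phi_at_even_sg_diff.
  by rewrite sgr_eq0 subr_eq0.
- exact: phi_alternates_step.
- exact: alternates_across_zeros_window sign (xi_alternates pat) xi_at_window.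
- rewrite !xi_at_window => /eqP + /eqP; rewrite !window_sign_eq0//.
  move=> /andP[/eqP xi1 /eqP xi2N] /andP[/eqP xi2 /eqP xi3].
  apply: steps_at_overlap => //; apply: steps_at_overlap => //;
    by apply: zeros_constant => //; lia.
- rewrite !xi_at_window /window_sign => u0 u1 u2.
  have [xi0 xi1 xi2 xi3 xi4] : [/\ xi_at w n i != 0,
      xi_at w n i.+1 = - xi_at w n i, xi_at w n i.+2 = xi_at w n i,
      xi_at w n i.+3 = - xi_at w n i & xi_at w n i.+4 = xi_at w n i].
    move: (sign i) (sign i.+1) (sign i.+2) (sign i.+3) (sign i.+4) => *.
    by split; lia.
  apply: steps_at_overlap => //; apply: steps_at_overlap => //;
    by apply: sign_changes_alternating => //; lia.
Qed.

End EvenStep.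

Lemma xi_at2 (w : nat -> bool) i :
  xi_at w 2 i = if w i.+1 == w i then 0 else letter_sign (w i.+1).
Proof.
by rewrite /xi_at factorE /mkseq /= addn0 addn1; case: (w i); case: (w i.+1).
Qed.

Lemma phi_at2 (w : nat -> bool) i :
  phi_at w 2 i = if w i.+1 == w i then 0 else letter_sign (w i.+1).
Proof.
by rewrite /phi_at factorE /mkseq /= addn0 addn1; case: (w i); case: (w i.+1).
Qed.

Lemma even_pattern2 (w : nat -> bool) : even_pattern w 2.
Proof.
have phi_xi i : phi_at w 2 i = xi_at w 2 i by rewrite phi_at2 xi_at2.
have phi_alt := @phi_alternates_step w 0 isT (even_pattern0 w).
have xi_eq0 i : (xi_at w 2 i == 0) = constant_at w 2 i.
  by rewrite xi_at2 steps_at2 addbF; case: (w i); case: (w i.+1).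
have xi_neq0 i : (xi_at w 2 i != 0) = alternating_at w 2 i.
  by rewrite xi_eq0 !steps_at2 addbF addbT; case: (w i); case: (w i.+1).
split=> [i||i j _ [ij]|i /eqP + /eqP|i xi0 xi1 xi2].
- by rewrite phi_xi.
- exact: phi_alt.
- rewrite -!phi_xi => phi_i phi_j xi_zero.
  by apply: phi_alt; split=> // l /xi_zero; rewrite phi_xi.
- by rewrite !xi_eq0; apply: steps_at_overlap.
- by do 2 ![apply: steps_at_overlap => //];
    rewrite -xi_neq0 ?xi2 ?xi1 ?oppr_eq0.
Qed.

Lemma even_patternP (w : nat -> bool) n : ~~ odd n -> even_pattern w n.
Proof.
move=> /even_halfK <-; elim: n./2 => [|[_|k IHk]].
- exact: even_pattern0.
- exact: even_pattern2.
- by rewrite doubleS; apply: even_pattern_step; rewrite // odd_double.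
Qed.

Section PsiAlternates.

Variable w : nat -> bool.

Lemma psi_atE n i : psi_at w n i = xi_at w n i ^+ n * phi_at w n i.
Proof. by rewrite /psi_at /psi size_factor. Qed.

Lemma psi_at_even n i : ~~ odd n -> psi_at w n i = phi_at w n i.
Proof.
move=> n_even; have xi_phi := xi_phi_eq0 (even_patternP w n_even) i.
rewrite psi_atE; case: n n_even xi_phi => [|n] n_even xi_phi.
  by rewrite mul1r.
rewrite (sign_expr _ (xi_at_sign_valued w n.+1 i))// (negbTE n_even) xi_phi.
by have [->|_] := eqVneq; rewrite ?mulr0 ?mul1r.
Qed.

Lemma psi_at_odd n i : ~~ odd n ->
  psi_at w n.+1 i =
  Num.sg (xi_at w n i.+1 * phi_at w n i.+1 - xi_at w n i * phi_at w n i).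
Proof.
move=> n_even; have pat := even_patternP w n_even.
rewrite psi_atE (sign_expr _ (xi_at_sign_valued w n.+1 i))//= n_even.
rewrite xi_atS /= ?n_even//.
have [/andP[/eqP-> /eqP->]|] :=
  boolP ((xi_at w n i == 0) && (xi_at w n i.+1 == 0)).
  by rewrite addr0 !mul0r subrr sgr0.
rewrite negb_and => xi_neq0; rewrite phi_at_odd_sg_diff// sg_add_mul_sg_diff//.
- exact: xi_at_sign_valued.
- exact: phi_at_sign_valued.
- exact: xi_phi_eq0.
- exact: phi_alternates.
Qed.

Lemma psi_at_alternates n : alternates (psi_at w n).
Proof.
have [n_odd|n_even] := boolP (odd n); last first.
  move=> i j [ij]; rewrite !psi_at_even// => ui uj u_zero.
  apply: (phi_alternates (even_patternP w n_even)); split=> // l /u_zero.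
  by rewrite psi_at_even.
case: n n_odd => // n n_even; have pat := even_patternP w n_even.
apply: (@alternates_sg_diff (fun i => xi_at w n i * phi_at w n i)).
- move=> i; have := xi_at_sign_valued w n i; have := phi_at_sign_valued w n i.
  nia.
- apply: constant_across_zeros_mul (xi_phi_eq0 pat) (xi_alternates pat) _.
  exact: alternatesW (phi_alternates pat).
- by move=> i; apply: psi_at_odd.
Qed.

End PsiAlternates.

Local Close Scope ring_scope.

Theorem theorem5p5 (k n : nat) (hk : 1 <= k) (w : nat -> bool)
  (hw : forall j : nat, j <= k ->
     (colourable (factor w j (j + n)) <-> j = 0 \/ j = k)) :
  psi (factor w 0 n) <> psi (factor w k (k + n)).
Proof.
have psi_neq0 j : j <= k -> (psi_at w n j != 0%R) = (j == 0) || (j == k).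
  by move=> /hw[col colP]; apply/idP/pred2P => [/eqP/col|/colP/eqP].
have psi_ends : consecutive_nonzero (psi_at w n) 0 k.
  split; rewrite ?psi_neq0 ?eqxx ?orbT// => l /andP[l_gt0 l_lt_k].
  by apply/eqP/negPn; rewrite psi_neq0 ?(ltnW l_lt_k)// gtn_eqF// ltn_eqF.
have := psi_at_alternates psi_ends; case: psi_ends => _ psi0 _ _.
by rewrite /psi_at add0n in psi0 *; move=> ->; lia.
Qed.
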